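(* Let $d\ge1$ and let $T$ be a linear operator on $L^2(\mathbb{R}^d)\cap L^\infty(\mathbb{R}^d)$ which is a contraction with respect to the norm $\|\cdot\|_\infty$. If $\Gamma_2(T)$ is a contraction on the quadratic Fock space $\Gamma_2(L^2(\mathbb{R}^d)\cap L^\infty(\mathbb{R}^d))$, then $T$ is a contraction on $L^2(\mathbb{R}^d)\cap L^\infty(\mathbb{R}^d)$ with respect to the norm $\|\cdot\|_2$.
   Context: All function spaces consist of complex-valued functions modulo a.e. equality for Lebesgue measure on $\mathbb{R}^d$, and $\langle f,g\rangle=\int_{\mathbb{R}^d}\overline{f(s)}g(s)\,ds$. Fix a constant $c>0$. A contraction with respect to a norm $\|\cdot\|$ is an operator $T$ with $\|Tf\|\le\|f\|$ for all $f$. Quadratic Fock space. $\Gamma_2(L^2(\mathbb{R}^d)\cap L^\infty(\mathbb{R}^d))$ is the Hilbert space which is the closed linear span of vectors $B^{+n}_f\Phi$, $n\in\mathbb{N}$, $f\in L^2(\mathbb{R}^d)\cap L^\infty(\mathbb{R}^d)$, where $B_f^{+0}\Phi=\Phi$ is a unit vector, vectors with different $n$ are orthogonal, and for $n\ge1$ $$\langle B^{+n}_f\Phi,B^{+n}_g\Phi\rangle=c\sum_{k=0}^{n-1}2^{2k+1}\frac{n!(n-1)!}{((n-k-1)!)^2}\langle f^{k+1},g^{k+1}\rangle\langle B^{+(n-k-1)}_f\Phi,B^{+(n-k-1)}_g\Phi\rangle .$$ Quadratic exponential vectors. For $f\in L^2(\mathbb{R}^d)\cap L^\infty(\mathbb{R}^d)$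 with $\|f\|_\infty<\frac12$, the vector $\Psi(f)=\sum_{n\ge0}\frac{1}{n!}B_f^{+n}\Phi$ exists (with $\Psi(0)=\Phi$), and $$\langle\Psi(f),\Psi(g)\rangle=\exp\Big(-\frac c2\int_{\mathbb{R}^d}\ln\big(1-4\overline{f(s)}g(s)\big)\,ds\Big).$$ These vectors are linearly independent and total, so this formula determines the space up to unitary equivalence. Quadratic quantization. For a linear operator $T$ on $L^2(\mathbb{R}^d)\cap L^\infty(\mathbb{R}^d)$ that is a contraction for $\|\cdot\|_\infty$, $\Gamma_2(T)$ is the linear operator determined by $\Gamma_2(T)\Psi(f)=\Psi(Tf)$ for all $f$ with $\|f\|_\infty<\frac12$, defined on the (dense) linear span of these exponential vectors and, when it is bounded there, extended by continuity to the whole quadratic Fock space. *)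

(* Defs.v *)
From HB Require Import structures.
From mathcomp Require Import all_boot all_order all_algebra.
From mathcomp Require Import generic_quotient ring_quotient complex.
From mathcomp Require Import all_classical all_reals all_analysis.
From mathcomp Require Import measurable_realfun ess_sup_inf.

Set Implicit Arguments.
Unset Strict Implicit.
Unset Printing Implicit Defensive.

Import Order.TTheory GRing.Theory Num.Theory.
Import numFieldNormedType.Exports.

Local Open Scope classical_set_scope.
Local Open Scope ring_scope.
Local Open Scope quotient_scope.

Notation modc := ComplexField.Normc.normc.

Section lebesgue_measure_Rd.
Context {R : realType}.

Definition tcons n (x : measurableTypeR R * n.-tuple (measurableTypeR R)) :
  n.+1.-tuple (measurableTypeR R) := [tuple of x.1 :: x.2].

Lemma measurable_tcons n : measurable_fun setT (@tcons n).
Proof. exact: measurable_cons. Qed.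

Section step.
Variables (n : nat)
  (m : {sigma_finite_measure set (n.-tuple (measurableTypeR R)) -> \bar R}).

(* Product of the Lebesgue measure on R with m, seen on (n+1)-tuples. *)
Definition lebesgue_step : set (n.+1.-tuple (measurableTypeR R)) -> \bar R :=
  pushforward (@lebesgue_measure R \x m)%E (@tcons n).

Let lebesgue_step0 : lebesgue_step set0 = 0%E.
Proof. by rewrite /lebesgue_step /pushforward preimage_set0 measure0. Qed.

Let lebesgue_step_ge0 A : (0 <= lebesgue_step A)%E.
Proof. by have mf := @measurable_tcons n; exact: measure_ge0. Qed.

Let lebesgue_step_sigma_additive : semi_sigma_additive lebesgue_step.
Proof. by have mf := @measurable_tcons n; exact: measure_semi_sigma_additive. Qed.

HB.instance Definition _ := isMeasure.Build _ _ _ lebesgue_step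
  lebesgue_step0 lebesgue_step_ge0 lebesgue_step_sigma_additive.

Lemma lebesgue_step_sigma_finite : sigma_finite setT lebesgue_step.
Proof.
pose g (t : n.+1.-tuple (measurableTypeR R)) :=
  (thead t, [tuple of behead t]).
have mg : measurable_fun setT g.
  apply/measurable_fun_pair; first exact: measurable_tnth.
  exact: measurable_behead.
have gK x : g (tcons x) = x.
  by case: x => a b; rewrite /g theadE; congr pair; exact/val_inj.
have /sigma_finiteP[F [TF ndF Foo]] := sigma_finiteT (@lebesgue_measure R).
have /sigma_finiteP[G [TG ndG Goo]] := sigma_finiteT m.
exists (fun i => g @^-1` (F i `*` G i)).
  rewrite -preimage_bigcup (_ : \bigcup_i _ = setT) ?preimage_setT//.
  rewrite -setXTT TF TG predeqE => -[x y]; split.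
    by move=> [p _ []/= ? ?]; split; exists p.
  move=> [/= [p _ Fpx] [k _ Gky]]; exists (maxn p k) => //; split.
  - by move: x Fpx; exact/subsetPset/ndF/leq_maxl.
  - by move: y Gky; exact/subsetPset/ndG/leq_maxr.
move=> i; have [? ?] := Foo i; have [? ?] := Goo i.
have mFG : measurable (F i `*` G i) by exact: measurableX.
split; first by rewrite -[X in measurable X]setTI; exact: mg.
rewrite /lebesgue_step /pushforward.
rewrite (_ : _ @^-1` _ = F i `*` G i); last first.
  by rewrite -comp_preimage (_ : _ \o _ = id)//; apply/funext => x /=; rewrite gK.
by rewrite product_measure1E// lte_mul_pinfty// ge0_fin_numE.
Qed.

HB.instance Definition _ := @Measure_isSigmaFinite.Build _ _ _ lebesgue_step
  lebesgue_step_sigma_finite.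

End step.

Fixpoint lebesgue_Rd (n : nat) :
    {sigma_finite_measure set (n.-tuple (measurableTypeR R)) -> \bar R} :=
  match n with
  | 0 => \d_([tuple] : 0.-tuple (measurableTypeR R))
  | n'.+1 => lebesgue_step (lebesgue_Rd n')
  end.

End lebesgue_measure_Rd.

Section L2oo.
Variables (R : realType) (d : nat).
Local Notation RT := (measurableTypeR R).
Local Notation Rd := (d.-tuple RT).
Local Notation mu := (@lebesgue_Rd R d).
Implicit Types f g : Rd -> R[i].

(* Borel measurability; passing to Lebesgue-measurable functions would not
   change the classes modulo a.e. equality. *)
Definition cmeasurable_fun f :=
  measurable_fun setT (fun s => complex.Re (f s) : RT) /\
  measurable_fun setT (fun s => complex.Im (f s) : RT).

(* The L^p norm, as a norm of the real function |f|. *)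
Definition Cnorm (p : \bar R) f : \bar R :=
  ('N[mu]_p[EFin \o (fun s => modc (f s))])%E.

Definition Cintegral f : R[i] :=
  Complex (\int[mu]_s complex.Re (f s)) (\int[mu]_s complex.Im (f s)).

Definition Cdot f g : R[i] := Cintegral (fun s => (f s)^* * g s).

Lemma measurable_modc f : cmeasurable_fun f ->
  measurable_fun setT (fun s => modc (f s) : RT).
Proof.
move=> [mre mim]; rewrite (_ : (fun s => _) = fun s => Num.sqrt
  (complex.Re (f s) ^+ 2 + complex.Im (f s) ^+ 2)); last first.
  by apply/funext => s; case: (f s).
apply: (@measurableT_comp _ _ _ _ _ _ (@Num.sqrt R)).
  exact: (continuous_measurable_fun (@sqrt_continuous R)).
by apply: measurable_funD; exact: measurable_funX.
Qed.

Lemma le_Lnorm p (h k : Rd -> R) : (1 <= p)%E ->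
  measurable_fun setT (h : Rd -> RT) -> measurable_fun setT (k : Rd -> RT) ->
  (forall s, 0 <= h s <= k s) ->
  ('N[mu]_p[EFin \o h] <= 'N[mu]_p[EFin \o k])%E.
Proof.
move=> p1 mh mk hk.
have hkn s : `|h s| <= `|k s|.
  by have /andP[h0 hks] := hk s; rewrite !ger0_norm// (le_trans h0).
rewrite unlock; case: p p1 => [r|_|//].
  rewrite lee_fin => r1; apply: gt0_ler_poweR.
  - by rewrite invr_ge0 (le_trans ler01).
  - rewrite in_itv/= leey andbT; apply: integral_ge0 => s _ ; rewrite ?poweR_ge0 ?lee_fin ?powR_ge0//.
  - rewrite in_itv/= leey andbT; apply: integral_ge0 => s _ ; rewrite ?poweR_ge0 ?lee_fin ?powR_ge0//.
  apply: ge0_le_integral => //.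
  - by move=> s _; rewrite lee_fin powR_ge0.
  - apply: (measurableT_comp (measurable_poweR r)); apply: measurableT_comp => //.
    exact/measurable_EFinP.
  - apply: (measurableT_comp (measurable_poweR r)); apply: measurableT_comp => //.
    exact/measurable_EFinP.
  move=> s _; rewrite /= lee_fin.
  by apply: ge0_ler_powR; rewrite ?nnegrE// (le_trans ler01).
by case: ifPn => // _; apply: le_ess_sup; apply: nearW => s /=; rewrite lee_fin.
Qed.

Lemma cmeasurable_funD f g : cmeasurable_fun f -> cmeasurable_fun g ->
  cmeasurable_fun (f + g).
Proof.
move=> [fr fi] [gr gi]; split.
  rewrite (_ : (fun s => _) =
    (fun s => complex.Re (f s)) \+ (fun s => complex.Re (g s))).
    exact: measurable_funD.
  by apply/funext => s /=; rewrite fctE; case: (f s) (g s) => [a b] [].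
rewrite (_ : (fun s => _) =
  (fun s => complex.Im (f s)) \+ (fun s => complex.Im (g s))).
  exact: measurable_funD.
by apply/funext => s /=; rewrite fctE; case: (f s) (g s) => [a b] [].
Qed.

Lemma cmeasurable_funZ (a : R[i]) f : cmeasurable_fun f ->
  cmeasurable_fun (a *: f).
Proof.
case: a => x y [fr fi]; split.
  rewrite (_ : (fun s => _) =
    (fun s => x * complex.Re (f s)) \- (fun s => y * complex.Im (f s))).
    by apply: measurable_funB; exact: measurable_funM.
  by apply/funext => s /=; rewrite fctE; case: (f s).
rewrite (_ : (fun s => _) =
  (fun s => x * complex.Im (f s)) \+ (fun s => y * complex.Re (f s))).
  by apply: measurable_funD; exact: measurable_funM.
by apply/funext => s /=; rewrite fctE; case: (f s).
Qed.

Lemma CnormD p f g : (1 <= p)%E -> cmeasurable_fun f -> cmeasurable_fun g ->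
  (Cnorm p (f + g)%R <= Cnorm p f + Cnorm p g)%E.
Proof.
move=> p1 mf mg; apply: le_trans (@eminkowski _ _ _ mu _ _ p
  (measurable_modc mf) (measurable_modc mg) p1).
apply: le_Lnorm => //.
- exact: measurable_modc (cmeasurable_funD mf mg).
- by apply: measurable_funD; exact: measurable_modc.
move=> s; rewrite fctE /= le_normcD andbT.
by case: (f s + g s) => x y; exact: sqrtr_ge0.
Qed.

Lemma CnormZ_lty p a f : (1 <= p)%E -> cmeasurable_fun f ->
  (Cnorm p f < +oo)%E -> (Cnorm p (a *: f)%R < +oo)%E.
Proof.
move=> p1 mf foo.
have fL : (fun s => modc (f s)) \in Lfun mu p.
  by rewrite inE; apply/andP; split; rewrite inE//=; exact: measurable_modc.
have [L0 LZ] := Lfun_submod_closed mu p1.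
have := LZ (modc a) _ 0 fL L0; rewrite addr0 inE => /andP[_].
rewrite inE /finite_norm /Cnorm /= => aoo; rewrite (_ : (fun s => _) =
  modc a *: (fun s => modc (f s)))//.
by apply/funext => s; rewrite fctE /= ComplexField.Normc.normcM.
Qed.

Definition L2oo_pred : {pred Rd -> R[i]} :=
  mem [set f | [/\ cmeasurable_fun f, (Cnorm 2%:E f < +oo)%E &
                   (Cnorm +oo f < +oo)%E]].

Lemma L2oo_submod_closed : submod_closed L2oo_pred.
Proof.
have Cnorm0 p : (1 <= p)%E -> Cnorm p 0 = 0%E.
  move=> p1; rewrite -[RHS](Lnorm0 mu (p := p)); last first.
    by rewrite gt_eqF// (lt_le_trans _ p1).
  by apply: eq_Lnorm => s; congr EFin; exact: ComplexField.Normc.normc0.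
have two1 : (1 <= 2%:E :> \bar R)%E by rewrite lee_fin ler1n.
have oo1 : (1 <= +oo :> \bar R)%E by rewrite leey.
split.
  rewrite inE; split; rewrite ?Cnorm0 ?ltry//.
move=> a f g; rewrite !inE => -[mf f2 foo] [mg g2 goo].
have maf := cmeasurable_funZ a mf.
split; first exact: cmeasurable_funD.
- by apply: le_lt_trans (CnormD _ _ _) _; rewrite // lte_add_pinfty// CnormZ_lty.
- by apply: le_lt_trans (CnormD _ _ _) _; rewrite // lte_add_pinfty// CnormZ_lty.
Qed.

HB.instance Definition _ := GRing.isSubmodClosed.Build _ _ L2oo_pred
  L2oo_submod_closed.

Record L2oo_fun := L2ooFun { L2oo_val :> Rd -> R[i]; _ : L2oo_val \in L2oo_pred }.

HB.instance Definition _ := [isSub for L2oo_val].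
HB.instance Definition _ := [Choice of L2oo_fun by <:].
HB.instance Definition _ := [SubChoice_isSubLmodule of L2oo_fun by <:].

Definition L2oo_null : {pred L2oo_fun} :=
  mem [set u : L2oo_fun | {ae mu, forall s, u s = 0}].

Lemma L2oo_null_submod_closed : submod_closed L2oo_null.
Proof.
split; first by rewrite inE; apply: nearW.
move=> a u v; rewrite !inE; apply: filterS2 => s us vs.
by rewrite [LHS](_ : _ = a * u s + v s)// us vs mulr0 addr0.
Qed.

HB.instance Definition _ := GRing.isSubmodClosed.Build _ _ L2oo_null
  L2oo_null_submod_closed.

(* L^2 \cap L^oo modulo a.e. equality. *)
Definition L2oo : Type := Quotient.quot L2oo_null.

HB.instance Definition _ := GRing.Zmodule.on L2oo.
HB.instance Definition _ := EqQuotient.on L2oo.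

Definition L2oo_scale (a : R[i]) (f : L2oo) : L2oo := \pi_L2oo (a *: repr f).

Lemma pi_L2oo_scale a (u : L2oo_fun) : \pi_L2oo (a *: u) = L2oo_scale a (\pi u).
Proof.
apply/eqP; rewrite -Quotient.idealrBE -scalerBr rpredZ// Quotient.idealrBE.
by rewrite reprK.
Qed.

Lemma L2oo_scaleA a b (f : L2oo) :
  L2oo_scale a (L2oo_scale b f) = L2oo_scale (a * b) f.
Proof.
elim/quotW: f => u.
by rewrite -(pi_L2oo_scale b u) -(pi_L2oo_scale a) -(pi_L2oo_scale _ u) scalerA.
Qed.

Lemma L2oo_scale1 : left_id 1 L2oo_scale.
Proof. by move=> f; rewrite -[f]reprK -pi_L2oo_scale scale1r. Qed.

Lemma L2oo_scaleDr : right_distributive L2oo_scale +%R.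
Proof.
move=> a; elim/quotW => u; elim/quotW => v.
rewrite -(pi_L2oo_scale a u) -(pi_L2oo_scale a v).
rewrite -[in LHS](raddfD (\pi_L2oo)) -[in RHS](raddfD (\pi_L2oo)).
by rewrite -pi_L2oo_scale scalerDr.
Qed.

Lemma L2oo_scaleDl (f : L2oo) : {morph L2oo_scale^~ f : a b / a + b}.
Proof.
move=> a b; elim/quotW: f => u; rewrite -!(pi_L2oo_scale _ u) scalerDl.
exact: (raddfD (\pi_L2oo)).
Qed.

HB.instance Definition _ := GRing.Zmodule_isLmodule.Build R[i] L2oo
  L2oo_scaleA L2oo_scale1 L2oo_scaleDr L2oo_scaleDl.

(* A representative; all the uses below are invariant under a.e. equality. *)
Definition L2oo_to_fun (f : L2oo) : Rd -> R[i] := repr f.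

End L2oo.

Coercion L2oo_to_fun : L2oo >-> Funclass.

Lemma L2ooP (R : realType) (d : nat) (f g : L2oo R d) :
  f = g <-> {ae (@lebesgue_Rd R d), forall s, f s = g s}.
Proof.
rewrite -[X in X = _](@reprK _ (L2oo R d)) -[X in _ = X](@reprK _ (L2oo R d)).
split=> [/eqP|h].
  rewrite -Quotient.idealrBE inE; apply: filterS => s /eqP.
  by rewrite [X in X == _](_ : _ = f s - g s)// subr_eq0 => /eqP.
apply/eqP; rewrite -Quotient.idealrBE inE; apply: filterS h => s h.
by rewrite [LHS](_ : _ = f s - g s)// h subrr.
Qed.

(* The values of N live in an ordered type, since the norms at hand are valued
   in \bar R on function spaces and in R[i] on Hilbert spaces. *)
Definition contraction_for d (O : porderType d) (V : Type) (N : V -> O)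
  (T : V -> V) : Prop := forall x, (N (T x) <= N x)%O.

Definition linear_span (K : pzRingType) (V : lmodType K) (A : set V) : set V :=
  [set x | exists2 s : seq (K * V), {in s, forall p, A p.2} &
             x = \sum_(p <- s) p.1 *: p.2].

(* hdot is linear in its second argument. *)
Record hilbertSpace (R : realType) := HilbertSpace {
  hilbert_sort :> completeNormedModType R[i];
  hdot : hilbert_sort -> hilbert_sort -> R[i];
  hdot_linear : forall x, scalar (hdot x);
  hdotC : forall x y, hdot y x = (hdot x y)^*;
  hdotE : forall x, hdot x x = `|x| ^+ 2
}.

(* Bplus n f stands for B^{+n}_f Phi and vacuum for Phi. These data are
   determined up to unitary equivalence, so a statement about the quadratic
   Fock space quantifies over all of them. *)
Record quadraticFockSpace (R : realType) (d : nat) (c : R) := QuadraticFockSpace {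
  fock_sort :> hilbertSpace R;
  vacuum : fock_sort;
  Bplus : nat -> L2oo R d -> fock_sort;
  Bplus0 : forall f, Bplus 0 f = vacuum;
  vacuum_unit : `|vacuum| = 1;
  Bplus_orthogonal : forall m n f g, m != n ->
    hdot (Bplus m f) (Bplus n g) = 0;
  Bplus_dot : forall n f g, (1 <= n)%N ->
    hdot (Bplus n f) (Bplus n g) =
      (c%:C)%C * \sum_(0 <= k < n)
        2 ^+ (2 * k + 1) * (n`! * (n - 1)`!)%:R / ((n - k - 1)`! ^ 2)%:R *
        Cdot (fun s => f s ^+ (k + 1)) (fun s => g s ^+ (k + 1)) *
        hdot (Bplus (n - k - 1) f) (Bplus (n - k - 1) g);
  Bplus_total :
    closure (linear_span [set x | exists n f, x = Bplus n f]) = setT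
}.

Section quadratic_quantization.
Variables (R : realType) (d : nat) (c : R) (F : quadraticFockSpace d c).

Definition quadratic_exp (f : L2oo R d) : F :=
  lim (series (fun n => (n`!%:R : R[i])^-1 *: Bplus F n f) @ \oo).

(* The exponential vectors are linearly independent and total, so such a G is
   unique; it exists exactly when the operator that T induces on their span is
   bounded, and it is then the continuous extension of that operator. *)
Definition is_Gamma2 (T : {linear L2oo R d -> L2oo R d})
    (G : {linear F -> F}) : Prop :=
  continuous G /\
  forall f : L2oo R d, (Cnorm +oo f < (2^-1)%:E)%E ->
    G (quadratic_exp f) = quadratic_exp (T f).

End quadratic_quantization.

(* Main.v *)
Require Import Defs.
From HB Require Import structures.
From mathcomp Require Import all_boot all_order all_algebra.
From mathcomp Require Import complex.
From mathcomp Require Import all_classical all_reals all_analysis.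
From mathcomp Require Import measurable_realfun ess_sup_inf.
From mathcomp Require Import ring lra.

Set Implicit Arguments.
Unset Strict Implicit.
Unset Printing Implicit Defensive.

Import Order.TTheory GRing.Theory Num.Theory.
Import numFieldNormedType.Exports.

Local Open Scope classical_set_scope.
Local Open Scope ring_scope.

(** Write a_n(f) for the squared norm of the n-th term of the series Psi(f).
    The recursion for B^{+n}_f Phi gives a_0 = 1, a_1(f) = 2c |f|_2^2 and
    a_n(f) <= D^n as soon as D >= 2c |f|_2^2 and D >= 4 |f|_oo^2.  Both lower
    bounds on D scale like t^2 when f is replaced by t f, so that
      1 + 2c t^2 |f|_2^2 <= |Psi(t f)|^2 <= 1 + 2c t^2 |f|_2^2 + 2 t^4 D^2
    for small t.  Comparing the lower bound for T f with the upper bound for f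
    through |Psi(t T f)| <= |Psi(t f)|, the t^2 coefficients yield the claim. *)

(** * Norms and even moments of classes in [L2oo] *)

Section L2oo_norms.
Variables (R : realType) (d : nat).
Local Notation mu := (@lebesgue_Rd R d).
Implicit Types f g : L2oo R d.

(** This is the inner product of [f^k] with itself, as a real number. An infinite integral would be
    read as 0, so finiteness has to be checked whenever extended-real bounds are transferred to
    it. *)
Definition even_moment f (k : nat) : R :=
  \int[mu]_s (modc (f s) ^+ (2 * k)).

Lemma L2oo_cmeasurable f : cmeasurable_fun f.
Proof. by have := valP (repr f); rewrite inE => -[]. Qed.

Lemma Cnorm2_lty f : (Cnorm 2%:E f < +oo)%E.
Proof. by have := valP (repr f); rewrite inE => -[]. Qed.

Lemma Cnormoo_lty f : (Cnorm +oo f < +oo)%E.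
Proof. by have := valP (repr f); rewrite inE => -[]. Qed.

Lemma modc_ge0 (z : R[i]) : 0 <= modc z.
Proof. by case: z => a b; exact: sqrtr_ge0. Qed.

Lemma modcX (z : R[i]) n : modc (z ^+ n) = modc z ^+ n.
Proof.
elim: n => [|n IH]; first exact: ComplexField.Normc.normc1.
by rewrite !exprS ComplexField.Normc.normcM IH.
Qed.

Lemma mulJc (z : R[i]) : z^* * z = (modc z ^+ 2)%:C%C.
Proof. by rewrite mulrC -normCK -rmorphXn. Qed.

Lemma CdotXX f k :
  Cdot (fun s => f s ^+ k) (fun s => f s ^+ k) = (even_moment f k)%:C%C.
Proof.
rewrite /Cdot /Cintegral; congr Complex.
  apply: eq_Rintegral => s _; rewrite mulJc /=.
  by rewrite modcX -exprM mulnC.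
rewrite (_ : (fun s => _) = cst 0) ?Rintegral_cst ?mul0r//.
by apply/funext => s; rewrite mulJc.
Qed.

Lemma measurable_EFin_modcX f n :
  measurable_fun setT (fun s => (modc (f s) ^+ n)%:E).
Proof.
apply/measurable_EFinP; apply: measurable_funX; apply: measurable_modc.
exact: L2oo_cmeasurable.
Qed.

Lemma Cnorm2E f :
  (Cnorm 2%:E f `^ 2 = \int[mu]_s (modc (f s) ^+ 2)%:E)%E.
Proof.
rewrite poweR_Lnorm; last by rewrite pnatr_eq0.
apply: eq_integral => s _; rewrite /= ger0_norm ?modc_ge0//.
by rewrite powR_mulrn ?modc_ge0.
Qed.

Lemma even_moment1 f : (even_moment f 1)%:E = (Cnorm 2%:E f `^ 2)%E.
Proof.
rewrite /even_moment /Rintegral -[X in fine X]Cnorm2E fineK//.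
by rewrite ge0_fin_numE ?poweR_ge0// poweR_lty// Cnorm2_lty.
Qed.

Lemma even_moment_ge0 f k : 0 <= even_moment f k.
Proof. by apply: Rintegral_ge0 => s _; rewrite exprn_ge0// modc_ge0. Qed.

Lemma le_Cnorm2 f g : even_moment f 1 <= even_moment g 1 ->
  (Cnorm 2%:E f <= Cnorm 2%:E g)%E.
Proof.
rewrite -lee_fin !even_moment1.
have := Lnorm_ge0 mu 2%:E (EFin \o (fun s => modc (f s))); rewrite -/(Cnorm _ f).
have := Lnorm_ge0 mu 2%:E (EFin \o (fun s => modc (g s))); rewrite -/(Cnorm _ g).
move: (Cnorm2_lty f) (Cnorm2_lty g).
case: (Cnorm 2%:E f) (Cnorm 2%:E g) => [x| |] [y| |]// _ _.
rewrite !poweR_EFin !lee_fin => y0 x0.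
by rewrite !powR_mulrn// ler_pXn2r.
Qed.

Lemma L2oo_ae_bounded f :
  exists2 M : R, 0 <= M & {ae mu, forall s, modc (f s) <= M}.
Proof.
have := Cnormoo_lty f.
(* The norm of order [+oo] is 0 by convention when the whole space is null; any bound then holds
   a.e. *)
rewrite /Cnorm unlock; case: ifPn => [_|mu0 _]; last first.
  exists 0 => //.
  have mu0' : mu setT = 0%E by apply/eqP; rewrite eq_le measure_ge0 andbT leNgt.
  by exists setT; split => // s _.
move=> /ess_supr_bounded[M hM]; exists (Num.max 0 M); first by rewrite le_max lexx.
apply: filterS hM => s /=; rewrite ger0_norm ?modc_ge0// => h.
by rewrite le_max h orbT.
Qed.

Lemma Cnormoo_lt f (M K : R) : 0 <= M < K ->
  {ae mu, forall s, modc (f s) <= M} -> (Cnorm +oo f < K%:E)%E.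
Proof.
move=> /andP[M0 MK] fM; rewrite /Cnorm unlock; case: ifPn => _; last first.
  by rewrite lte_fin (le_lt_trans M0).
apply: (@le_lt_trans _ _ M%:E); last by rewrite lte_fin.
apply/ess_supP; apply: filterS fM => s /=.
by rewrite lee_fin ger0_norm ?modc_ge0.
Qed.

Lemma even_moment_le f (M : R) k : 0 <= M -> {ae mu, forall s, modc (f s) <= M} ->
  even_moment f k.+1 <= M ^+ (2 * k) * even_moment f 1.
Proof.
move=> M0 fM.
have Mk : 0 <= M ^+ (2 * k) by rewrite exprn_ge0.
have e1 : (\int[mu]_s (modc (f s) ^+ (2 * 1))%:E = (even_moment f 1)%:E)%E.
  by rewrite even_moment1 Cnorm2E.
(* Working with extended-real integrals gives finiteness of the left-hand side along with the bound,
   so that [fine] can be removed afterwards. *)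
have le : (\int[mu]_s (modc (f s) ^+ (2 * k.+1))%:E <=
    (M ^+ (2 * k) * even_moment f 1)%:E)%E.
  rewrite EFinM -e1 -ge0_integralZl//=; last first.
  - by move=> s _; rewrite lee_fin exprn_ge0// modc_ge0.
  - exact: measurable_EFin_modcX.
  apply: ae_ge0_le_integral => //.
  - by move=> s _; rewrite lee_fin exprn_ge0// modc_ge0.
  - exact: measurable_EFin_modcX.
  - by move=> s _; rewrite -EFinM lee_fin mulr_ge0// exprn_ge0// modc_ge0.
  - by apply: measurable_funeM; exact: measurable_EFin_modcX.
  apply: filterS fM => s fsM _; rewrite -EFinM lee_fin mulnS addnC exprD.
  by rewrite ler_wpM2r ?exprn_ge0 ?modc_ge0// lerXn2r ?nnegrE ?modc_ge0.
rewrite -lee_fin; apply: (le_trans _ le); rewrite /even_moment /Rintegral fineK//.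
rewrite ge0_fin_numE; last first.
  by apply: integral_ge0 => s _; rewrite lee_fin exprn_ge0// modc_ge0.
exact: le_lt_trans le (ltry _).
Qed.

(** Values are read off chosen representatives, and the one chosen for [a *: f] need not be [a]
    times the one chosen for [f]; only a.e. equality is available. *)
Lemma L2oo_scaleE (a : R[i]) f :
  {ae mu, forall s, (a *: f : L2oo R d) s = a * f s}.
Proof.
have : \pi_(L2oo R d)%qT (repr (a *: f)) = \pi_(L2oo R d)%qT (a *: repr f).
  by rewrite pi_L2oo_scale !reprK.
move=> /eqP; rewrite -Quotient.idealrBE inE; apply: filterS => s /eqP.
rewrite [X in X == _](_ : _ = (a *: f : L2oo R d) s - a * f s)//.
by rewrite subr_eq0 => /eqP.
Qed.

Lemma even_moment1Z (a : R[i]) f :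
  even_moment (a *: f) 1 = modc a ^+ 2 * even_moment f 1.
Proof.
apply: EFin_inj; rewrite EFinM !even_moment1 !Cnorm2E -ge0_integralZl//=; last first.
- by rewrite lee_fin exprn_ge0// modc_ge0.
- by move=> s _; rewrite lee_fin exprn_ge0// modc_ge0.
- exact: measurable_EFin_modcX.
apply: ge0_ae_eq_integral => //.
- exact: measurable_EFin_modcX.
- by apply: measurable_funeM; exact: measurable_EFin_modcX.
- by move=> s _; rewrite lee_fin exprn_ge0// modc_ge0.
- by move=> s _; rewrite -EFinM lee_fin mulr_ge0// exprn_ge0// modc_ge0.
apply: filterS (L2oo_scaleE a f) => s h _; rewrite h -EFinM.
by rewrite ComplexField.Normc.normcM exprMn.
Qed.

End L2oo_norms.

(** * Series of orthogonal vectors with geometrically decaying norms *)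

Section hilbert.
Variables (R : realType) (H : hilbertSpace R).
Implicit Types (x y z : H).

Lemma hdotDr x y z : hdot x (y + z) = hdot x y + hdot x z.
Proof. by have := hdot_linear x 1 y z; rewrite scale1r /= mul1r. Qed.

Lemma hdotr0 x : hdot x 0 = 0.
Proof. by apply: (addrI (hdot x 0)); rewrite -hdotDr !addr0. Qed.

Lemma hdot_sumr (I : Type) (r : seq I) (P : pred I) (v : I -> H) y :
  hdot y (\sum_(i <- r | P i) v i) = \sum_(i <- r | P i) hdot y (v i).
Proof. exact: (big_morph _ (hdotDr y) (hdotr0 y)). Qed.

Lemma hdotZr (a : R[i]) x y : hdot x (a *: y) = a * hdot x y.
Proof. by have := hdot_linear x a y 0; rewrite /= hdotr0 !addr0. Qed.

Lemma hdotZl (a : R[i]) x y : hdot (a *: x) y = a^* * hdot x y.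
Proof. by rewrite hdotC hdotZr rmorphM/= -hdotC. Qed.

Lemma hdotDl x y z : hdot (x + y) z = hdot x z + hdot y z.
Proof. by rewrite hdotC hdotDr rmorphD/= -!hdotC. Qed.

Lemma normD_orthogonal x y : hdot x y = 0 ->
  `|x + y| ^+ 2 = `|x| ^+ 2 + `|y| ^+ 2.
Proof.
move=> xy0; have yx0 : hdot y x = 0 by rewrite hdotC xy0 rmorph0.
by rewrite -!hdotE hdotDl !hdotDr xy0 yx0 addr0 add0r.
Qed.

Variable v : nat -> H.
Hypothesis v_orthogonal : forall m n, m != n -> hdot (v m) (v n) = 0.

Lemma norm_sum_orthogonal m n : `|\sum_(m <= k < n) v k| ^+ 2 =
  \sum_(m <= k < n) `|v k| ^+ 2.
Proof.
have [mn|/ltnW nm] := leqP m n; last first.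
  by rewrite !big_geq// normr0 expr0n.
elim: n mn => [|n IH]; first by move=> _; rewrite !big_geq// normr0 expr0n.
rewrite leq_eqVlt => /predU1P[->|mn].
  by rewrite !big_geq// normr0 expr0n.
rewrite !big_nat_recr//= normD_orthogonal ?IH//.
rewrite hdotC hdot_sumr big_nat big1 ?rmorph0// => k /andP[_ kn].
by apply: v_orthogonal; rewrite gtn_eqF.
Qed.

Variable D : R.
Hypotheses (D_ge0 : 0 <= D) (D_le : D <= 2^-1).
Hypothesis v_le : forall n, `|v n| ^+ 2 <= (D ^+ n)%:C%C.

Lemma norm_sum_geometric m n :
  `|\sum_(m <= k < n) v k| ^+ 2 <= (2 * D ^+ m)%:C%C.
Proof.
rewrite norm_sum_orthogonal.
apply: le_trans (_ : (\sum_(m <= k < n) D ^+ k)%:C%C <= _).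
  by rewrite rmorph_sum/=; apply: ler_sum => k _.
rewrite lecR; have [mn|/ltnW nm] := leqP m n; last first.
  by rewrite big_geq// mulr_ge0// exprn_ge0.
(* Adding the bound [2 * D ^+ n] for the remaining tail makes the induction go through:
   [D ^+ n + 2 * D ^+ n.+1 <= 2 * D ^+ n] because [D <= 1/2]. *)
suff : \sum_(m <= k < n) D ^+ k + 2 * D ^+ n <= 2 * D ^+ m.
  by apply: le_trans; rewrite lerDl mulr_ge0// exprn_ge0.
elim: n mn => [|n IH]; first by rewrite leqn0 => /eqP ->; rewrite big_geq// add0r.
rewrite leq_eqVlt => /predU1P[->|mn]; first by rewrite big_geq// add0r.
apply: le_trans (IH mn); rewrite big_nat_recr//= -addrA lerD2l exprS.
have : D * D ^+ n <= 2^-1 * D ^+ n by rewrite ler_wpM2r// exprn_ge0.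
lra.
Qed.

Lemma cvg_series_orthogonal : cvgn (series v).
Proof.
apply/cauchy_cvgP/cauchy_seriesP => e e0.
(* A positive element of [R[i]] is real for the partial order of the complex numbers. *)
have [r r0 ->] : exists2 r : R, 0 < r & e = r%:C%C.
  by case: e e0 => a b; rewrite ltcE/= => /andP[/eqP -> a0]; exists a.
have : (GRing.exp D) @ \oo --> (0 : R).
  by apply: cvg_expr; rewrite ger0_norm// (le_lt_trans D_le)// invf_lt1// ltr1n.
(* Squared norms of blocks are at most [2 * D ^+ m], which [D ^+ m < r ^+ 2 / 2] brings below
   [r ^+ 2]. *)
move=> /cvgrPdist_lt/(_ (r ^+ 2 / 2)).
rewrite divr_gt0 ?exprn_gt0// => /(_ isT) [N _ hN].
exists ([set m | (N <= m)%N], [set n | (N <= n)%N]) => /=.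
  by split; exists N.
move=> [m n] /= [Nm _]; rewrite -(@ltr_pXn2r _ 2) ?nnegrE ?ler0c ?(ltW r0)//.
apply: le_lt_trans (norm_sum_geometric m n) _.
rewrite -rmorphXn ltcR; have := hN _ Nm.
rewrite /= sub0r normrN ger0_norm ?exprn_ge0//; lra.
Qed.

(** The first two terms are split off by orthogonality; the rest is a block starting at 2. *)
Lemma sqr_norm_series_le n : (2 <= n)%N ->
  `|v 0| ^+ 2 + `|v 1| ^+ 2 <= `|series v n| ^+ 2 <=
  `|v 0| ^+ 2 + `|v 1| ^+ 2 + (2 * D ^+ 2)%:C%C.
Proof.
move=> n2; rewrite /series/= norm_sum_orthogonal big_ltn ?(ltn_trans _ n2)//.
rewrite big_ltn// addrA -norm_sum_orthogonal lerDl lerD2l exprn_ge0//=.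
exact: norm_sum_geometric.
Qed.

Lemma sqr_norm_lim_series :
  `|v 0| ^+ 2 + `|v 1| ^+ 2 <= `|lim (series v @ \oo)| ^+ 2 <=
  `|v 0| ^+ 2 + `|v 1| ^+ 2 + (2 * D ^+ 2)%:C%C.
Proof.
set a := _ + _; set b := _ + _%:C%C; set l := lim _.
have a0 : 0 <= a by rewrite addr_ge0// exprn_ge0.
have b0 : 0 <= b by rewrite addr_ge0// ler0c mulr_ge0// exprn_ge0.
have close (e : R[i]) : 0 < e ->
    exists n, `|l - series v n| < e /\ a <= `|series v n| ^+ 2 <= b.
  move=> e0; have /cvgrPdist_lt/(_ _ e0)[N _ hN] := cvg_series_orthogonal.
  exists (maxn N 2); split; first by apply: hN => /=; rewrite leq_maxl.
  exact/sqr_norm_series_le/leq_maxr.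
(* After taking square roots the bounds concern norms, so the triangle inequality carries them from
   a close partial sum to [l] up to an arbitrary [e]. *)
rewrite -[a]sqrtCK -[b]sqrtCK !ler_pXn2r ?nnegrE ?sqrtC_ge0//.
apply/andP; split; apply/ler_addgt0Pr => e e0;
    have [n [le_e /andP[an nb]]] := close e e0.
  apply: le_trans (_ : `|series v n| <= _).
    by rewrite -(@ler_pXn2r _ 2) ?nnegrE ?sqrtC_ge0// sqrtCK.
  rewrite -[series v n](subrK l) addrC (le_trans (ler_normD _ _))// lerD2l.
  by rewrite distrC ltW.
rewrite -[l](subrK (series v n)) addrC (le_trans (ler_normD _ _))// lerD//.
  by rewrite -(@ler_pXn2r _ 2) ?nnegrE ?sqrtC_ge0// sqrtCK.
exact: ltW.
Qed.

End hilbert.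

(** * Norms of quadratic exponential vectors *)

Section quadratic_exp_norm.
Variables (R : realType) (d : nat) (c : R) (F : quadraticFockSpace d c).
Hypothesis c_gt0 : 0 < c.
Implicit Types f g : L2oo R d.

Definition exp_term f n : F := (n`!%:R : R[i])^-1 *: Bplus F n f.

Lemma exp_term_orthogonal f m n : m != n ->
  hdot (exp_term f m) (exp_term f n) = 0.
Proof. by move=> mn; rewrite hdotZl hdotZr Bplus_orthogonal// !mulr0. Qed.

Lemma hdot_BplusE f n :
  hdot (Bplus F n f) (Bplus F n f) = (n`! ^ 2)%:R * `|exp_term f n| ^+ 2.
Proof.
rewrite normrZ exprMn -hdotE mulrA ger0_norm ?invr_ge0// natrX exprVn.
by rewrite divff ?mul1r// expf_neq0// pnatr_eq0 -lt0n fact_gt0.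
Qed.

Lemma sqr_norm_exp_term0 f : `|exp_term f 0| ^+ 2 = 1.
Proof. by rewrite /exp_term fact0 invr1 scale1r Bplus0 vacuum_unit expr1n. Qed.

(** Dividing the recursion for [Bplus] by the square of [n.+1] factorial cancels all factorials
    except for a factor [1 / n.+1]. *)
Lemma sqr_norm_exp_term f n : `|exp_term f n.+1| ^+ 2 =
  (c / n.+1%:R)%:C%C * \sum_(k < n.+1)
    (2 ^+ (2 * k + 1) * even_moment f k.+1)%:C%C * `|exp_term f (n - k)| ^+ 2.
Proof.
have nz m : (m`!%:R : R[i]) != 0 by rewrite pnatr_eq0 -lt0n fact_gt0.
apply: (mulfI (_ : ((n.+1)`! ^ 2)%:R != 0 :> R[i])); first by rewrite natrX expf_neq0.
rewrite -hdot_BplusE Bplus_dot// big_mkord !big_distrr/=.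
apply: eq_bigr => k _; rewrite CdotXX !subn1 !addn1 subSn ?leq_ord//=.
rewrite hdot_BplusE !rmorphM/= fmorphV rmorph_nat rmorphXn rmorph_nat.
rewrite factS !natrM; field.
by rewrite nz -[1]/(1%:R) -natrD pnatr_eq0.
Qed.

Lemma sqr_norm_exp_term1 f : `|exp_term f 1| ^+ 2 = (2 * c * even_moment f 1)%:C%C.
Proof.
rewrite sqr_norm_exp_term big_ord1 sqr_norm_exp_term0 mulr1 divr1.
by rewrite -rmorphM/= expr1 mulrA [c * 2]mulrC.
Qed.

(** By strong induction, summand [k] of the recursion is at most [2 * even_moment f 1 * (4 * M ^+ 2)
    ^+ k * D ^+ (n - k)], hence at most [2 * even_moment f 1 * D ^+ n]. The factor [1 / n.+1]
    compensates for the number of summands, and [2 * c * even_moment f 1 <= D] supplies the last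
    power. *)
Lemma sqr_norm_exp_term_le f (M D : R) n : 0 <= M ->
  {ae (@lebesgue_Rd R d), forall s, modc (f s) <= M} ->
  2 * c * even_moment f 1 <= D -> 4 * M ^+ 2 <= D ->
  `|exp_term f n| ^+ 2 <= (D ^+ n)%:C%C.
Proof.
move=> M0 fM JD MD.
have D0 : 0 <= D by apply: le_trans MD; rewrite mulr_ge0// exprn_ge0.
elim/ltn_ind: n => -[_|n IH]; first by rewrite sqr_norm_exp_term0 expr0.
rewrite sqr_norm_exp_term.
apply: (@le_trans _ _ ((c / n.+1%:R)%:C%C *
    \sum_(k < n.+1) (2 * even_moment f 1 * D ^+ n)%:C%C)).
  rewrite ler_wpM2l ?ler0c ?divr_ge0 ?(ltW c_gt0)//.
  apply: ler_sum => k _.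
  have pk : 0 <= 2 ^+ (2 * k + 1) * even_moment f k.+1.
    by rewrite mulr_ge0 ?exprn_ge0 ?even_moment_ge0.
  apply: (@le_trans _ _
      (2 ^+ (2 * k + 1) * even_moment f k.+1 * D ^+ (n - k))%:C%C).
    by rewrite [leRHS]rmorphM ler_wpM2l ?ler0c// IH// ltnS leq_subr.
  rewrite lecR -[in X in _ <= X](subnKC (leq_ord k)) (exprD D) mulrA.
  rewrite ler_wpM2r ?exprn_ge0//.
  apply: (@le_trans _ _ (2 ^+ (2 * k + 1) * (M ^+ (2 * k) * even_moment f 1))).
    by rewrite ler_wpM2l ?exprn_ge0// even_moment_le.
  rewrite (_ : _ * _ = 2 * even_moment f 1 * (4 * M ^+ 2) ^+ k); last first.
    rewrite exprMn -!exprM exprD expr1 (_ : 4 = 2 ^+ 2); last by rewrite -natrX.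
    by rewrite -exprM; ring.
  rewrite ler_wpM2l ?mulr_ge0 ?even_moment_ge0// lerXn2r ?nnegrE//.
  by rewrite mulr_ge0// exprn_ge0.
rewrite sumr_const card_ord -rmorphMn -rmorphM lecR /= exprS.
rewrite [leLHS](_ : _ = 2 * c * even_moment f 1 * D ^+ n).
  by rewrite ler_wpM2r ?exprn_ge0.
by rewrite -mulr_natr; field; rewrite -[1]/(1%:R) -natrD pnatr_eq0.
Qed.

Lemma sqr_norm_quadratic_exp f (M D : R) : 0 <= M ->
  {ae (@lebesgue_Rd R d), forall s, modc (f s) <= M} ->
  2 * c * even_moment f 1 <= D -> 4 * M ^+ 2 <= D -> D <= 2^-1 ->
  (1 + 2 * c * even_moment f 1)%:C%C <= `|quadratic_exp F f| ^+ 2 <=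
  (1 + 2 * c * even_moment f 1 + 2 * D ^+ 2)%:C%C.
Proof.
move=> M0 fM JD MD D2.
have D0 : 0 <= D by apply: le_trans MD; rewrite mulr_ge0// exprn_ge0.
have := sqr_norm_lim_series (exp_term_orthogonal f) D0 D2
  (fun n => sqr_norm_exp_term_le n M0 fM JD MD).
by rewrite sqr_norm_exp_term0 sqr_norm_exp_term1 -!rmorphD/=.
Qed.

End quadratic_exp_norm.

(** * Comparison of the second-order coefficients *)

Theorem proposition2 (R : realType) (d : nat) (hd : (1 <= d)%N)
    (c : R) (hc : 0 < c)
    (F : quadraticFockSpace d c)
    (T : {linear L2oo R d -> L2oo R d})
    (T_contraction_oo : contraction_for (fun f : L2oo R d => Cnorm +oo f) T)
    (G : {linear F -> F})
    (G_Gamma2 : is_Gamma2 T G)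
    (G_contraction : contraction_for (fun x : F => `|x|) G) :
  contraction_for (fun f : L2oo R d => Cnorm 2%:E f) T.
Proof.
move=> f; apply: le_Cnorm2; rewrite leNgt; apply/negP => ltJ.
have [M M0 fM] := L2oo_ae_bounded f.
have [N N0 TfN] := L2oo_ae_bounded (T f).
have Jf := even_moment_ge0 f 1; have JTf := even_moment_ge0 (T f) 1.
(* One constant serves [f] and [T f] alike, as [b < a] by contradiction; the summand 1 gives
   [1 <= D], used in choosing [t]. *)
pose D := 1 + 2 * c * even_moment (T f) 1 + 4 * M ^+ 2 + 4 * N ^+ 2.
set a := even_moment (T f) 1 in ltJ JTf D *; set b := even_moment f 1 in ltJ Jf.
have M2 : 0 <= M ^+ 2 by rewrite exprn_ge0.
have N2 : 0 <= N ^+ 2 by rewrite exprn_ge0.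
have ca : 0 <= c * a by rewrite mulr_ge0// ltW.
have cb : c * b < c * a by rewrite ltr_pM2l.
have D1 : 1 <= D by rewrite /D; lra.
have [t t0 [tD tab]] : exists2 t : R, 0 < t &
    t ^+ 2 * D <= 2^-1 /\ t ^+ 2 * D ^+ 2 < c * a - c * b.
  (* With [t = e / D] one has [t * D = e] and [t <= e], so [t ^+ 2 * D <= e * e] and
     [t ^+ 2 * D ^+ 2 = e * e], while [e * e <= e / 2]. *)
  pose e := Num.min 2^-1 ((c * a - c * b) / 2).
  have e0 : 0 < e by rewrite lt_min invr_gt0 ltr0n /=; lra.
  have e12 : e <= 2^-1 by rewrite ge_min lexx.
  have eab : e <= (c * a - c * b) / 2 by rewrite ge_min lexx orbT.
  have D0 : 0 < D by lra.
  have De : e / D <= e by rewrite ler_pdivrMr// ler_peMr// ltW.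
  have ee : e * e <= 2^-1 * e by rewrite ler_wpM2r// ltW.
  exists (e / D); first by rewrite divr_gt0.
  have eD : e / D * D = e by rewrite divfK// gt_eqF.
  rewrite -exprMn eD !expr2 -mulrA eD.
  have : e / D * e <= e * e by rewrite ler_wpM2r// ltW.
  by split; lra.
have ttD : 0 <= t ^+ 2 by rewrite exprn_ge0// ltW.
have aeZ (g : L2oo R d) (K : R) :
    {ae (@lebesgue_Rd R d), forall s, modc (g s) <= K} ->
    {ae (@lebesgue_Rd R d), forall s, modc ((t%:C%C *: g : L2oo R d) s) <= t * K}.
  apply: filterS2 (L2oo_scaleE t%:C%C g) => s ->.
  rewrite ComplexField.Normc.normcM /= expr0n addr0 sqrtr_sqr ger0_norm ?(ltW t0)//.
  by move=> gK; rewrite ler_wpM2l// ltW.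
have JZ (g : L2oo R d) : even_moment (t%:C%C *: g) 1 = t ^+ 2 * even_moment g 1.
  by rewrite even_moment1Z /= expr0n addr0 sqrtr_sqr ger0_norm ?(ltW t0).
(* This puts [t *: f] in the domain of the exponential vectors: [4 * K ^+ 2 <= 1/2 < 1]. *)
have lt12 K : 0 <= K -> 4 * K ^+ 2 <= t ^+ 2 * D -> K < 2^-1.
  move=> K0 KD; rewrite -(@ltr_pXn2r _ 2) ?nnegrE ?invr_ge0//.
  by rewrite (_ : 2^-1 ^+ 2 = 4^-1); [lra | field].
have tM : 0 <= t * M by rewrite mulr_ge0// ltW.
have tN : 0 <= t * N by rewrite mulr_ge0// ltW.
have le_D x : x <= D -> t ^+ 2 * x <= t ^+ 2 * D by move=> ?; rewrite ler_wpM2l.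
have MD : 4 * (t * M) ^+ 2 <= t ^+ 2 * D.
  by rewrite exprMn mulrCA le_D// /D; lra.
have ND : 4 * (t * N) ^+ 2 <= t ^+ 2 * D.
  by rewrite exprMn mulrCA le_D// /D; lra.
have JfD : 2 * c * even_moment (t%:C%C *: f) 1 <= t ^+ 2 * D.
  by rewrite JZ mulrCA le_D// /D -/b; lra.
have JTfD : 2 * c * even_moment (t%:C%C *: T f) 1 <= t ^+ 2 * D.
  by rewrite JZ mulrCA le_D// /D -/a; lra.
have /andP[_ up] := sqr_norm_quadratic_exp F hc tM (aeZ _ _ fM) JfD MD tD.
have /andP[lo _] := sqr_norm_quadratic_exp F hc tN (aeZ _ _ TfN) JTfD ND tD.
have [_ /(_ (t%:C%C *: f)) GE] := G_Gamma2.
have := G_contraction (quadratic_exp F (t%:C%C *: f)).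
rewrite GE ?linearZ; last first.
  by apply: Cnormoo_lt (aeZ _ _ fM); rewrite tM lt12.
rewrite -(@ler_pXn2r _ 2) ?nnegrE// => /(le_trans lo)/le_trans/(_ up).
rewrite lecR !JZ -/a -/b -subr_ge0.
(* The upper bound minus the lower bound must be nonnegative, but [t] was chosen to make the last
   factor negative. *)
rewrite (_ : _ - _ = 2 * t ^+ 2 * (t ^+ 2 * D ^+ 2 - (c * a - c * b))).
  by rewrite pmulr_rge0 ?mulr_gt0 ?exprn_gt0// subr_ge0 leNgt tab.
by move: (D) => E; ring.
Qed.
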